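(* Let $A\in\mathbb{R}^{n\times n}$. Consider a randomized Arnoldi factorization of size $k$ and an equivalent randomized Krylov-Schur factorization of order $k$, both with the same matrix $\Omega$ and the same last vector $u_{k+1}$, $$A V = V H + \beta\, u_{k+1} e_k^T,\qquad A U = U T + u_{k+1} b^T,\qquad \operatorname{span}\{V\}=\operatorname{span}\{U\}.$$ Let both be subjected to one cycle of an expansion step to length $k+p$ followed by a contraction step back to length $k$, using the randomized Implicitly Restarted Arnoldi method (rIRA) for the first and the randomized Krylov-Schur method (rKS) for the second, where both methods retain the same $k$ Ritz values and discard the same $p$ Ritz values, and assume the retained Ritz values are distinct from the discarded ones. Then the resulting factorizations of length $k$ are equivalent in the sense that their spans are equal: if $V^+$ and $U^+$ are the $n\times k$ bases produced by rIRA and rKS respectively, then $\operatorname{span}\{V^+\}=\operatorname{span}\{U^+\}$.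
   Context: Exact arithmetic is assumed. The span of a matrix is the span of its columns; $e_i$ are canonical basis vectors; $\mathcal{K}_j(A,v)=\operatorname{span}\{v,Av,\dots,A^{j-1}v\}$. For $\epsilon\in[0,1)$, $\Omega\in\mathbb{R}^{d\times n}$ is an $\epsilon$-embedding for a subspace $\mathcal{S}$ if $(1-\epsilon)\|x\|^2\le\|\Omega x\|^2\le(1+\epsilon)\|x\|^2$ for all $x\in\mathcal{S}$. A matrix $M$ is sketch-orthonormal if $(\Omega M)^T(\Omega M)=I$. Standing assumptions: with $v_1=Ve_1$, $\dim\mathcal{K}_{k+p+1}(A,v_1)=k+p+1$ and $\Omega$ is an $\epsilon$-embedding for $\mathcal{K}_{k+p+1}(A,v_1)$. Randomized Arnoldi factorization of size $k$: $AV=VH+\beta u_{k+1}e_k^T$ with $H\in\mathbb{R}^{k\times k}$ upper-Hessenberg and $(V\;u_{k+1})$ sketch-orthonormal and a basis of $\mathcal{K}_{k+1}(A,v_1)$. Randomized Krylov-Schur factorization of order $k$: $AU=UT+u_{k+1}b^T$ with $T\in\mathbb{R}^{k\times k}$ of rank $k$ and block upper-triangular (real Schur form: diagonal blocks of size $1\times1$, or $2\times2$ for complex conjugate pairs of eigenvalues), and $(U\;u_{k+1})$ a sketch-orthonormal basis of a Krylov subspace $\mathcal{K}_{k+1}$. Expansion step (both methods; randomized Arnoldi): starting from the current basis $U_{k+1}=(V\;u_{k+1})$, respectively $(U\;u_{k+1})$, for $j=k+1,\dots,k+p$ set $w=Au_j$, $\tilde u=w-U_j(\Omega U_j)^\dagger\Omega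 w$, $u_{j+1}=\tilde u/\|\Omega\tilde u\|$, $U_{j+1}=(U_j\;u_{j+1})$. This yields factorizations $A V_{k+p}=V_{k+p}H_{k+p}+\hat\beta u_{k+p+1}e_{k+p}^T$ with $H_{k+p}$ upper-Hessenberg (rIRA), and $AU_{k+p}=U_{k+p}B_{k+p}+u_{k+p+1}b_{k+p}^T$ (rKS). The Ritz values are the eigenvalues of $H_{k+p}$, resp. $B_{k+p}$, counted with multiplicity; a set of $p$ of them, closed under complex conjugation, is discarded and the other $k$ are retained. Contraction step of rIRA: apply $p$ implicit shifted QR steps to $H_{k+p}$, with shifts the $p$ discarded Ritz values $\mu_1,\dots,\mu_p$; that is, with orthogonal $Q$ from the QR factorization $(H_{k+p}-\mu_1I)\cdots(H_{k+p}-\mu_pI)=QR$, replace $V_{k+p}$ by $V_{k+p}Q$ and $H_{k+p}$ by $Q^TH_{k+p}Q$, then truncate to the first $k$ columns: $V^+=V_{k+p}Q(e_1,\dots,e_k)$. Contraction step of rKS: reduce $B_{k+p}$ to real Schur form by an orthogonal similarity, and reorder the Schur form by an orthogonal similarity so that the $k$ retained Ritz values are in the upper-left $k\times k$ block and the $p$ discarded ones in the lower-right block; with $Q$ the total orthogonal transformation, truncate to the first $k$ columns: $U^+=U_{k+p}Q(e_1,\dots,e_k)$. *)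

(* Defs.v *)
From HB Require Import structures.
From mathcomp Require Import all_boot all_order all_algebra.
From mathcomp Require Export reals.
From mathcomp Require Export complex.

Set Implicit Arguments.
Unset Strict Implicit.
Unset Printing Implicit Defensive.

Import Order.TTheory GRing.Theory Num.Theory.
Local Open Scope ring_scope.

Section Spans.
Variable R : realType.

(* The canonical basis vector e_j of R^m, numbered from 1. *)
Definition evec (m j : nat) : 'cV[R]_m := \col_(i < m) (i.+1 == j)%:R.

Definition cols (n m : nat) (M : 'M[R]_(n, m)) : seq 'cV[R]_n :=
  [seq col j M | j <- enum 'I_m].

Definition mxcols (n : nat) (s : seq 'cV[R]_n) : 'M[R]_(n, size s) :=
  \matrix_(i < n, j < size s) (nth 0 s j) i 0.

Definition mxspan (n m : nat) (M : 'M[R]_(n, m)) : {vspace 'cV[R]_n} :=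
  <<cols M>>%VS.

Definition krylov (n : nat) (A : 'M[R]_n) (v : 'cV[R]_n) (j : nat) :
    {vspace 'cV[R]_n} :=
  <<[seq A ^+ i *m v | i <- iota 0 j]>>%VS.

(* Euclidean norm; the library norm on matrices is the sup norm. *)
Definition norm2 (m : nat) (x : 'cV[R]_m) : R :=
  Num.sqrt (\sum_(i < m) x i 0 ^+ 2).

End Spans.

Section MoorePenrose.
Variable R : realType.

(* Full-rank factorization M = C *m B gives
   M^+ = B^T (B B^T)^-1 (C^T C)^-1 C^T; the Penrose equations are checked in
   mp_pinvP. The library's pinvmx is not the Moore-Penrose inverse. *)
Definition mp_pinv (m n : nat) (M : 'M[R]_(m, n)) : 'M[R]_(n, m) :=
  let C := col_base M in let B := row_base M in
  B^T *m invmx (B *m B^T) *m (invmx (C^T *m C) *m C^T).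

Lemma gram_unitmx (m n : nat) (B : 'M[R]_(m, n)) :
  row_free B -> B *m B^T \in unitmx.
Proof.
move=> freeB; rewrite -row_free_unit -kermx_eq0.
apply/eqP/row_matrixP=> i; rewrite row0.
set x := row i _; have xG : x *m (B *m B^T) = 0.
  by rewrite /x -row_mul mulmx_ker row0.
have : (x *m B) *m (x *m B)^T = 0.
  by rewrite trmx_mul mulmxA -(mulmxA x) xG mul0mx.
move/matrixP/(_ 0 0); rewrite !mxE => /eqP.
under eq_bigr => j _ do rewrite (mxE _ _ j 0) -expr2.
rewrite psumr_eq0; last by move=> j _; rewrite sqr_ge0.
move=> /allP xB0; have : x *m B = 0.
  apply/rowP=> j; rewrite [RHS]mxE; apply/eqP.
  by have := xB0 j (mem_index_enum _); rewrite /= sqrf_eq0.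
by rewrite -(mul0mx _ B) => /(row_free_inj freeB).
Qed.

Lemma mp_pinvP (m n : nat) (M : 'M[R]_(m, n)) (P := mp_pinv M) :
  [/\ M *m P *m M = M, P *m M *m P = P,
      (M *m P)^T = M *m P & (P *m M)^T = P *m M].
Proof.
rewrite {}/P /mp_pinv; set C := col_base M; set B := row_base M.
have defM : M = C *m B by rewrite mulmx_base.
have uB : B *m B^T \in unitmx by rewrite gram_unitmx ?row_base_free.
have uC : C^T *m C \in unitmx.
  have := @gram_unitmx _ _ C^T; rewrite trmxK; apply.
  by rewrite /row_free mxrank_tr; exact: col_base_full.
clearbody C B; move: (\rank M) C B defM uB uC => r C B -> uB uC.
set Gi := invmx (B *m B^T); set Hi := invmx (C^T *m C).
have MP : C *m B *m (B^T *m Gi *m (Hi *m C^T)) = C *m Hi *m C^T.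
  rewrite !mulmxA -(mulmxA C B) -(mulmxA C (B *m B^T)) mulmxV //.
  by rewrite mulmx1.
have PM : B^T *m Gi *m (Hi *m C^T) *m (C *m B) = B^T *m Gi *m B.
  rewrite !mulmxA -(mulmxA _ C^T C) -(mulmxA _ Hi) mulVmx //.
  by rewrite mulmx1.
have GiT : Gi^T = Gi by rewrite trmx_inv trmx_mul trmxK.
have HiT : Hi^T = Hi by rewrite trmx_inv trmx_mul trmxK.
split.
- rewrite MP !mulmxA -(mulmxA _ C^T C) -(mulmxA _ Hi) mulVmx //.
  by rewrite mulmx1.
- rewrite PM !mulmxA -(mulmxA _ B B^T) -(mulmxA _ (B *m B^T) Gi).
  by rewrite mulmxV // mulmx1.
- by rewrite MP !trmx_mul trmxK HiT mulmxA.
- by rewrite PM !trmx_mul trmxK GiT mulmxA.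
Qed.

End MoorePenrose.

Section MatrixForms.
Variable R : realType.

Definition upper_hessenberg (m : nat) (M : 'M[R]_m) : Prop :=
  forall i j : 'I_m, (j.+1 < i)%N -> M i j = 0.

(* The library's is_trig_mx is lower triangular. *)
Definition upper_triangular (m : nat) (M : 'M[R]_m) : Prop := is_trig_mx M^T.

Definition orthogonal_mx (m : nat) (Q : 'M[R]_m) : Prop := Q^T *m Q = 1%:M.

(* A real 2 x 2 block carries a pair of complex conjugate eigenvalues exactly
   when it has no real eigenvalue. *)
Inductive real_schur : forall m : nat, 'M[R]_m -> Prop :=
| RealSchur0 (M : 'M[R]_0) : real_schur M
| RealSchur1 (m : nat) (D : 'M[R]_1) (N : 'M[R]_(1, m)) (S : 'M[R]_m) :
    real_schur S -> real_schur (block_mx D N 0 S)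
| RealSchur2 (m : nat) (D : 'M[R]_2) (N : 'M[R]_(2, m)) (S : 'M[R]_m) :
    (forall x : R, ~~ eigenvalue D x) ->
    real_schur S -> real_schur (block_mx D N 0 S).

(* s lists the complex eigenvalues of M with their algebraic multiplicities. *)
Definition has_spectrum (m : nat) (M : 'M[R]_m) (s : seq R[i]) : Prop :=
  map_poly (real_complex R) (char_poly M) = \prod_(z <- s) ('X - z%:P).

End MatrixForms.

Section RandomizedKrylov.
Variables (R : realType) (n d : nat) (A : 'M[R]_n) (Omega : 'M[R]_(d, n)).

Definition eps_embedding (eps : R) (S : {vspace 'cV[R]_n}) : Prop :=
  forall x : 'cV[R]_n, x \in S ->
    (1 - eps) * norm2 x ^+ 2 <= norm2 (Omega *m x) ^+ 2 <=
    (1 + eps) * norm2 x ^+ 2.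

Definition sketch_orthonormal (m : nat) (M : 'M[R]_(n, m)) : Prop :=
  (Omega *m M)^T *m (Omega *m M) = 1%:M.

Definition randomized_Arnoldi (k : nat) (V : 'M[R]_(n, k)) (H : 'M[R]_k)
    (beta : R) (u : 'cV[R]_n) : Prop :=
  [/\ A *m V = V *m H + beta *: (u *m (evec R k k)^T),
      upper_hessenberg H,
      sketch_orthonormal (row_mx V u) &
      basis_of (krylov A (V *m evec R k 1) k.+1) (cols (row_mx V u))].

Definition randomized_Krylov_Schur (k : nat) (U : 'M[R]_(n, k)) (T : 'M[R]_k)
    (b : 'cV[R]_k) (u : 'cV[R]_n) : Prop :=
  [/\ A *m U = U *m T + u *m b^T,
      real_schur T,
      \rank T = k,
      sketch_orthonormal (row_mx U u) &
      exists v : 'cV[R]_n, basis_of (krylov A v k.+1) (cols (row_mx U u))].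

(* s lists u_1, ..., u_j; the result appends u_(j+1). *)
Definition expansion_step (s : seq 'cV[R]_n) : seq 'cV[R]_n :=
  let Uj := mxcols s in
  let w := A *m last 0 s in
  let ut := w - Uj *m mp_pinv (Omega *m Uj) *m Omega *m w in
  rcons s ((norm2 (Omega *m ut))^-1 *: ut).

Definition expand (p : nat) (s : seq 'cV[R]_n) : seq 'cV[R]_n :=
  iter p expansion_step s.

(* ret and disc list the Ritz values of M that are retained and discarded. *)
Definition ritz_selection (k p : nat) (M : 'M[R]_(k + p)) (ret disc : seq R[i])
    : Prop :=
  [/\ size ret = k, size disc = p, has_spectrum M (ret ++ disc) &
      perm_eq [seq conjc z | z <- disc] disc].

(* The shifts may be complex, so the shifted product is formed over R[i]; it
   is real because disc is closed under conjugation. *)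
Definition rIRA_contraction (k p : nat) (H : 'M[R]_(k + p)) (disc : seq R[i])
    (Q : 'M[R]_(k + p)) : Prop :=
  orthogonal_mx Q /\
  exists2 Rf : 'M[R]_(k + p), upper_triangular Rf &
    \prod_(mu <- disc) (map_mx (real_complex R) H - mu%:M) =
    map_mx (real_complex R) (Q *m Rf).

(* Q1 reduces B to real Schur form, Q2 reorders that form. *)
Definition rKS_contraction (k p : nat) (B : 'M[R]_(k + p))
    (ret disc : seq R[i]) (Q : 'M[R]_(k + p)) : Prop :=
  exists Q1 Q2 : 'M[R]_(k + p),
    let S1 := Q1^T *m B *m Q1 in
    let S2 := Q2^T *m S1 *m Q2 in
    [/\ orthogonal_mx Q1 /\ real_schur S1,
        orthogonal_mx Q2 /\ real_schur S2,
        dlsubmx S2 = 0,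
        has_spectrum (ulsubmx S2) ret /\ has_spectrum (drsubmx S2) disc &
        Q = Q1 *m Q2].

Definition rIRA_cycle (k p : nat) (V : 'M[R]_(n, k)) (u : 'cV[R]_n)
    (ret disc : seq R[i]) (Vplus : 'M[R]_(n, k)) : Prop :=
  exists (Vkp : 'M[R]_(n, k + p)) (ukp : 'cV[R]_n) (Hkp : 'M[R]_(k + p))
         (beta : R) (Q : 'M[R]_(k + p)),
    [/\ cols (row_mx Vkp ukp) = expand p (cols (row_mx V u)),
        A *m Vkp = Vkp *m Hkp + beta *: (ukp *m (evec R (k + p) (k + p))^T)
          /\ upper_hessenberg Hkp,
        ritz_selection Hkp ret disc,
        rIRA_contraction Hkp disc Q &
        Vplus = lsubmx (Vkp *m Q)].

Definition rKS_cycle (k p : nat) (U : 'M[R]_(n, k)) (u : 'cV[R]_n)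
    (ret disc : seq R[i]) (Uplus : 'M[R]_(n, k)) : Prop :=
  exists (Ukp : 'M[R]_(n, k + p)) (ukp : 'cV[R]_n) (Bkp : 'M[R]_(k + p))
         (bkp : 'cV[R]_(k + p)) (Q : 'M[R]_(k + p)),
    [/\ cols (row_mx Ukp ukp) = expand p (cols (row_mx U u)),
        A *m Ukp = Ukp *m Bkp + ukp *m bkp^T,
        ritz_selection Bkp ret disc,
        rKS_contraction Bkp ret disc Q &
        Uplus = lsubmx (Ukp *m Q)].

End RandomizedKrylov.

(* Main.v *)
(** Write [m = k + p]. Both expansions produce the same last vector and the same
    span: the sketched projection of [w] depends only on the column space, since
    [Omega] is injective on the Krylov space and [G G^+] is the orthogonal
    projector onto the range of [G]. Hence [Um = Vm M] with [M] invertible, and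
    comparing the two factorizations gives [Hm M = M B].
    If [S] is the reordered Schur form of [B] and [psi] is the monic polynomial
    with the discarded Ritz values as roots, then [psi] kills the lower diagonal
    block of [S], so the range of [psi(Hm) = Q Rf] lies in the span of the first
    [k] columns of [P = M Q1 Q2]. Since [dim K_(m+1) = m+1], the Hessenberg matrix
    [Hm] is unreduced, so the first [k] columns of [psi(Hm)] are independent and
    span the same space as the first [k] columns of [Q]. The two spans thus have
    the same dimension [k], one being contained in the other. *)

Require Import Defs.
From mathcomp Require Import all_boot all_order all_algebra.
From mathcomp Require Import reals complex.

Set Implicit Arguments.
Unset Strict Implicit.
Unset Printing Implicit Defensive.

Import Order.TTheory GRing.Theory Num.Theory.
Local Open Scope ring_scope.

(** * Column spans as row spaces of transposes *)

Section ColumnSpan.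
Variable R : realType.

Lemma size_cols (n m : nat) (M : 'M[R]_(n, m)) : size (cols M) = m.
Proof. by rewrite size_map size_enum_ord. Qed.

Lemma nth_cols (n m : nat) (M : 'M[R]_(n, m)) (i : 'I_m) :
  nth 0 (cols M) i = col i M.
Proof. by rewrite (nth_map i) ?size_enum_ord // nth_ord_enum. Qed.

Lemma col_mem_cols (n m : nat) (M : 'M[R]_(n, m)) (i : 'I_m) : col i M \in cols M.
Proof. by rewrite -nth_cols mem_nth // size_cols. Qed.

Lemma cols_row_mx (n m : nat) (M : 'M[R]_(n, m)) (u : 'cV[R]_n) :
  cols (row_mx M u) = rcons (cols M) u.
Proof.
apply: (@eq_from_nth _ 0) => [|i]; first by rewrite size_rcons !size_cols addn1.
rewrite size_cols => lt_i; rewrite (nth_cols _ (Ordinal lt_i)) nth_rcons size_cols.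
have [lt_im | le_mi] := ltnP i m.
  have ->: Ordinal lt_i = lshift 1 (Ordinal lt_im) by exact: val_inj.
  rewrite (nth_cols _ (Ordinal lt_im)); apply/colP=> j.
  by rewrite [LHS]mxE row_mxEl [RHS]mxE.
have i_m : i = m by apply/eqP; rewrite eqn_leq le_mi andbT -ltnS -(addn1 m).
have ->: Ordinal lt_i = rshift m ord0 by apply: val_inj; rewrite /= addn0.
by rewrite i_m eqxx; apply/colP=> j; rewrite mxE row_mxEr.
Qed.

Lemma mulmx_sum_col (n m : nat) (M : 'M[R]_(n, m)) (y : 'cV[R]_m) :
  M *m y = \sum_j y j 0 *: col j M.
Proof.
apply/colP=> i; rewrite mxE summxE.
by apply: eq_bigr => j _; rewrite !mxE mulrC.
Qed.

Lemma mem_mxspan (n m : nat) (M : 'M[R]_(n, m)) (x : 'cV[R]_n) :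
  (x \in mxspan M) <-> exists y, x = M *m y.
Proof.
split=> [|[y ->]]; last first.
  rewrite mulmx_sum_col memv_suml // => j _; rewrite memvZ // memv_span //.
  exact: col_mem_cols.
rewrite /mxspan span_def big_map big_enum => /memv_sumP[vs vsP ->].
have [c vsE] : exists c : 'I_m -> R, forall j, vs j = c j *: col j M.
  by apply: (@fin_all_exists _ _ (fun j c => vs j = c *: col j M)) => j;
    apply/vlineP; exact: vsP.
exists (\col_j c j); rewrite mulmx_sum_col.
by apply: eq_bigr => j _; rewrite mxE vsE.
Qed.

(** Bridge to the row-space calculus, in which the rank arguments are carried out. *)
Lemma mxspan_sub (n m l : nat) (M : 'M[R]_(n, m)) (N : 'M[R]_(n, l)) :
  (mxspan M <= mxspan N)%VS = (M^T <= N^T)%MS.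
Proof.
apply/idP/idP=> [/subvP sMN | /submxP[X defM]].
  apply/row_subP=> i; rewrite -tr_col.
  have /sMN/mem_mxspan[y ->] : col i M \in mxspan M.
    by rewrite memv_span // col_mem_cols.
  by rewrite trmx_mul submxMl.
apply/subvP=> x /mem_mxspan[y ->]; apply/mem_mxspan; exists (X^T *m y).
by rewrite mulmxA -(trmxK M) defM trmx_mul trmxK.
Qed.

Lemma mxspan_mxcols (n : nat) (s : seq 'cV[R]_n) : mxspan (mxcols s) = <<s>>%VS.
Proof.
congr <<_>>%VS; apply: (@eq_from_nth _ 0) => [|i]; first by rewrite size_cols.
rewrite size_cols => lt_i; rewrite (nth_cols _ (Ordinal lt_i)).
by apply/colP=> j; rewrite !mxE.
Qed.

Lemma dim_mxspan_le_rank (n m : nat) (M : 'M[R]_(n, m)) :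
  (\dim (mxspan M) <= \rank M)%N.
Proof.
rewrite -[leqRHS](size_cols (col_base M)) (leq_trans _ (dim_span _)) // dimvS //.
by rewrite mxspan_sub; apply/submxP; exists (row_base M)^T; rewrite -trmx_mul mulmx_base.
Qed.

End ColumnSpan.

(** * Independence of the sketched expansion from the chosen basis *)

Section Sketching.
Variable R : realType.

Lemma norm2_eq0 (m : nat) (x : 'cV[R]_m) : norm2 x = 0 -> x = 0.
Proof.
move/eqP; rewrite sqrtr_eq0 => le0.
have := le0; rewrite le_eqVlt ltNge sumr_ge0 ?orbF; last first.
  by move=> i _; rewrite sqr_ge0.
rewrite psumr_eq0 => [/allP x0|i _]; last exact: sqr_ge0.
apply/colP=> i; rewrite mxE; apply/eqP.
by have := x0 i (mem_index_enum _); rewrite sqrf_eq0.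
Qed.

Lemma eps_embedding_inj (n d : nat) (Omega : 'M[R]_(d, n)) (eps : R)
    (S : {vspace 'cV[R]_n}) :
    eps < 1 -> eps_embedding Omega eps S ->
  forall x, x \in S -> Omega *m x = 0 -> x = 0.
Proof.
move=> lt_eps1 emb x /emb/andP[lower _] Ox0; apply: norm2_eq0; apply/eqP.
have nO : norm2 (Omega *m x) = 0.
  by rewrite Ox0 /norm2 big1 ?sqrtr0 // => i _; rewrite mxE expr0n.
move: lower; rewrite nO expr0n /= pmulr_rle0 ?subr_gt0 //.
by rewrite le_eqVlt ltNge sqr_ge0 orbF sqrf_eq0.
Qed.

(* [M *m mp_pinv M] is the orthogonal projector onto the column space. *)
Lemma mp_pinv_proj_eq (m k l : nat) (M : 'M[R]_(m, k)) (N : 'M[R]_(m, l)) :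
  (M^T == N^T)%MS -> M *m mp_pinv M = N *m mp_pinv N.
Proof.
case/andP=> /submxP[X defM] /submxP[Y defN].
have [MPM _ symM _] := mp_pinvP M; have [NPN _ symN _] := mp_pinvP N.
set P := M *m mp_pinv M in MPM symM *; set P' := N *m mp_pinv N in NPN symN *.
have {}defM : M = N *m X^T by rewrite -[M]trmxK defM trmx_mul trmxK.
have {}defN : N = M *m Y^T by rewrite -[N]trmxK defN trmx_mul trmxK.
have PP' : P *m P' = P' by rewrite /P' mulmxA {1}defN mulmxA MPM -defN.
have P'P : P' *m P = P by rewrite /P mulmxA {1}defM mulmxA NPN -defM.
(* Transposing [P *m P' = P'] gives [P' *m P = P'], and by [P'P] this same product is [P]. *)
by have := congr1 trmx PP'; rewrite trmx_mul symM symN P'P.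
Qed.

(** After applying [Omega], both sides are the orthogonal projection of [Omega *m w] onto the same
    range. Both lie in [mxspan M], where [Omega] is injective, so the equality lifts back. *)
Lemma sketched_projection_eq (n d k l : nat) (Omega : 'M[R]_(d, n))
    (M : 'M[R]_(n, k)) (N : 'M[R]_(n, l)) (w : 'cV[R]_n) :
    (forall x, x \in mxspan M -> Omega *m x = 0 -> x = 0) ->
    mxspan M = mxspan N ->
  M *m mp_pinv (Omega *m M) *m Omega *m w =
  N *m mp_pinv (Omega *m N) *m Omega *m w.
Proof.
move=> injO eqMN; apply/eqP; rewrite -subr_eq0; apply/eqP; apply: injO.
  rewrite memvB //; last rewrite eqMN.
    by apply/mem_mxspan; eexists; rewrite -!mulmxA.
  by apply/mem_mxspan; eexists; rewrite -!mulmxA.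
have : (Omega *m M) *m mp_pinv (Omega *m M) = (Omega *m N) *m mp_pinv (Omega *m N).
  apply: mp_pinv_proj_eq; rewrite !trmx_mul.
  by apply/andP; split; apply: submxMr; rewrite -mxspan_sub eqMN.
move: (mp_pinv _) (mp_pinv _) => P P' eqP.
by rewrite mulmxBr !mulmxA eqP subrr.
Qed.

Variables (n d : nat) (A : 'M[R]_n) (Omega : 'M[R]_(d, n)).

(** Invariant of the two expansions: the bases may differ, but the last vector, which determines
    [w], and the span of the preceding vectors agree. *)
Definition same_span_last (s t : seq 'cV[R]_n) : Prop :=
  exists a b x, [/\ s = rcons a x, t = rcons b x & <<a>>%VS = <<b>>%VS].

Lemma span_rcons (a : seq 'cV[R]_n) x : (<<rcons a x>> = <<a>> + <[x]>)%VS.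
Proof. by rewrite -cats1 span_cat span_seq1. Qed.

Lemma expansion_step_same (s t : seq 'cV[R]_n) :
    (forall x, x \in <<s>>%VS -> Omega *m x = 0 -> x = 0) ->
    same_span_last s t ->
  same_span_last (expansion_step A Omega s) (expansion_step A Omega t).
Proof.
move=> injO [a [b [x [s_ax t_bx eq_ab]]]].
have eq_st : <<s>>%VS = <<t>>%VS by rewrite s_ax t_bx !span_rcons eq_ab.
have eq_last : last 0 s = last 0 t by rewrite s_ax t_bx !last_rcons.
rewrite /expansion_step eq_last.
rewrite (@sketched_projection_eq _ _ _ _ Omega (mxcols s) (mxcols t)).
(* The appended vector is by now the same term on both sides; [s] and [t] become the preceding
   parts. *)
- by exists s, t; eexists; split.
- by rewrite mxspan_mxcols.
- by rewrite !mxspan_mxcols.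
Qed.

(** Injectivity on the final span suffices: the spans only grow, so every earlier step inherits
    it. *)
Lemma expand_same (p : nat) (s t : seq 'cV[R]_n) :
    (forall x, x \in <<expand A Omega p s>>%VS -> Omega *m x = 0 -> x = 0) ->
    same_span_last s t ->
  same_span_last (expand A Omega p s) (expand A Omega p t).
Proof.
elim: p => [|p IHp] //= injO st; apply: expansion_step_same.
  by move=> x xs; apply: injO; rewrite /expansion_step span_rcons (subvP (addvSl _ _)).
apply: IHp => // x xs; apply: injO.
by rewrite /expansion_step span_rcons (subvP (addvSl _ _)).
Qed.

Lemma nth_expand (p : nat) (s : seq 'cV[R]_n) (i : nat) :
  (i < size s)%N -> nth 0 (expand A Omega p s) i = nth 0 s i.
Proof.
move=> lt_i; elim: p => [|p <-] //=.
rewrite /expansion_step nth_rcons ifT // (leq_trans lt_i) //.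
by elim: p => [|p IHp] //=; rewrite size_rcons ltnW.
Qed.

End Sketching.

(** * Arnoldi relations, Krylov spaces and unreduced Hessenberg form *)

Section UnreducedHessenberg.
Variables (R : realType) (n : nat) (A : 'M[R]_n).

Lemma mulmx_span_take_sub (s : seq 'cV[R]_n) (j : nat) (W : {vspace 'cV[R]_n}) :
    (forall i, (i < j)%N -> (i < size s)%N -> A *m s`_i \in W) ->
  forall x, x \in <<take j s>>%VS -> A *m x \in W.
Proof.
(* The vectors that [A] sends into [W] form a subspace, so only generators need checking. *)
move=> sW x; suff /subvP/[apply] : (<<take j s>> <= linfun (mulmx A) @^-1: W)%VS.
  by rewrite -memv_preim lfunE.
apply/span_subvP=> y y_s; rewrite -memv_preim lfunE /= -(nth_index 0 y_s).
have lt_i : (index y (take j s) < minn j (size s))%N.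
  by rewrite -size_take_min index_mem.
move: lt_i; rewrite leq_min => /andP[lt_ij lt_is].
by rewrite nth_take // sW.
Qed.

Lemma krylov_subP (v : 'cV[R]_n) (j : nat) (W : {vspace 'cV[R]_n}) :
  (forall i, (i < j)%N -> A ^+ i *m v \in W) -> (krylov A v j <= W)%VS.
Proof.
move=> AvW; apply/span_subvP=> _ /mapP[i + ->].
by rewrite mem_iota => /andP[_]; apply: AvW.
Qed.

Lemma krylov_sub_stable (v : 'cV[R]_n) (j : nat) (W : {vspace 'cV[R]_n}) :
    v \in W -> (forall x, x \in W -> A *m x \in W) ->
  (krylov A v j <= W)%VS.
Proof.
move=> vW AW; apply: krylov_subP; elim=> [|i IHi] lt_ij.
  by rewrite expr0 mul1mx.
by rewrite exprS -mulmxE -mulmxA AW // IHi // ltnW.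
Qed.

Lemma nth_in_span_take (s : seq 'cV[R]_n) (i j : nat) :
  (i < j)%N -> (i < size s)%N -> s`_i \in <<take j s>>%VS.
Proof.
move=> lt_ij lt_is; rewrite -(nth_take _ lt_ij) memv_span // mem_nth //.
by rewrite size_take_min leq_min lt_ij.
Qed.

Section Chain.
Variables (s : seq 'cV[R]_n) (m : nat).
Hypothesis size_s : size s = m.+1.
Hypothesis chain_s :
  forall i, (i < m)%N -> A *m s`_i \in <<take i.+2 s>>%VS.

Lemma mulmx_span_take (j : nat) (x : 'cV[R]_n) : (j <= m)%N ->
  x \in <<take j s>>%VS -> A *m x \in <<take j.+1 s>>%VS.
Proof.
move=> le_jm; apply: mulmx_span_take_sub => i lt_ij _.
have := chain_s (leq_trans lt_ij le_jm).
apply/subvP; apply: sub_span => z; apply: mem_subseq.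
by rewrite -(@take_takel _ i.+2 j.+1) // take_subseq.
Qed.

Lemma krylov_sub_chain : (krylov A (s`_0) m.+1 <= <<s>>)%VS.
Proof.
apply: krylov_subP => i lt_im.
suff: A ^+ i *m s`_0 \in <<take i.+1 s>>%VS.
  by apply/subvP; apply: sub_span => z; apply: mem_take.
elim: i lt_im => [|i IHi] lt_im.
  by rewrite expr0 mul1mx nth_in_span_take // size_s.
by rewrite exprS -mulmxE -mulmxA mulmx_span_take // IHi // ltnW.
Qed.

(** Otherwise the span of the first [j.+1] vectors would be stable under [A] and contain the whole
    Krylov space, whose dimension [m.+1] is too large. *)
Lemma chain_unreduced (j : nat) :
    \dim (krylov A (s`_0) m.+1) = m.+1 -> (j < m)%N ->
  A *m s`_j \notin <<take j.+1 s>>%VS.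
Proof.
move=> dimK lt_jm; apply/negP=> Asj.
suff /dimvS : (krylov A (s`_0) m.+1 <= <<take j.+1 s>>)%VS.
  rewrite dimK => /leq_trans/(_ (dim_span _)).
  by rewrite size_take_min leq_min leqNgt ltnS lt_jm.
apply: krylov_sub_stable => [|x]; first by rewrite nth_in_span_take // size_s.
apply: mulmx_span_take_sub => i + _; rewrite ltnS leq_eqVlt => /predU1P[-> // | lt_ij].
have := chain_s (ltn_trans lt_ij lt_jm).
apply/subvP; apply: sub_span => z; apply: mem_subseq.
by rewrite -(@take_takel _ i.+2 j.+1) // take_subseq.
Qed.

End Chain.

Variables (m : nat) (V : 'M[R]_(n, m)) (H : 'M[R]_m) (beta : R) (u : 'cV[R]_n).
Let s := cols (row_mx V u).

Lemma nth_cols_row_mx (i : 'I_m) : s`_i = col i V.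
Proof. by rewrite /s cols_row_mx nth_rcons size_cols ltn_ord nth_cols. Qed.

Hypothesis AV : A *m V = V *m H + beta *: (u *m (evec R m m)^T).
Hypothesis hessH : upper_hessenberg H.

(** Only the last column carries the residual along [u], which sits at position [m] of [s]; the
    second hypothesis makes [j] reach past it there. Taking [j] to be [i.+2] gives the chain
    property; taking [i.+1] when the subdiagonal entry vanishes contradicts [chain_unreduced]. *)
Lemma arnoldi_column (i : 'I_m) (j : nat) :
    (forall l : 'I_m, (j <= l)%N -> H l i = 0) ->
    (i.+1 = m -> j = m.+1) ->
  A *m s`_i \in <<take j s>>%VS.
Proof.
move=> Hj im_j; have szs : size s = m.+1 by rewrite size_cols addn1.
have -> : A *m s`_i = \sum_l H l i *: s`_l + (beta * (i.+1 == m)%:R) *: s`_m.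
  rewrite nth_cols_row_mx colE mulmxA AV mulmxDl -mulmxA -colE mulmx_sum_col.
  congr (_ + _).
    by apply: eq_bigr => l _; rewrite nth_cols_row_mx mxE.
  rewrite /s cols_row_mx nth_rcons size_cols ltnn eqxx.
  rewrite -scalemxAl -mulmxA -scalerA -colE; congr (_ *: _).
  by apply/colP=> r; rewrite !mxE big_ord1 !mxE mulrC.
rewrite memvD //.
  apply: memv_suml => l _; have [/Hj-> | lt_lj] := leqP j l.
    by rewrite scale0r mem0v.
  by rewrite memvZ // nth_in_span_take // szs ltnS ltnW.
have [/im_j-> | _] := eqVneq i.+1 m; last by rewrite mulr0 scale0r mem0v.
by rewrite memvZ // nth_in_span_take // szs.
Qed.

Lemma arnoldi_chain (i : nat) :
  (i < m)%N -> A *m s`_i \in <<take i.+2 s>>%VS.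
Proof.
move=> lt_im; apply: (@arnoldi_column (Ordinal lt_im)) => [l|/= <- //].
exact: (@hessH l (Ordinal lt_im)).
Qed.

Lemma arnoldi_unreduced (i j : 'I_m) :
    \dim (krylov A s`_0 m.+1) = m.+1 -> i = j.+1 :> nat -> H i j != 0.
Proof.
move=> dimK i_j1; apply/negP=> /eqP Hij0.
have /negP[] := chain_unreduced (etrans (size_cols _) (addn1 m)) arnoldi_chain dimK (ltn_ord j).
apply: arnoldi_column => [l|jm]; last first.
  (* Column [j] is not the last one, since row [j.+1] exists. *)
  by have := ltn_ord i; rewrite i_j1 -[in X in (_ < X)%N]jm ltnn.
rewrite leq_eqVlt => /predU1P[j1_l | ]; last exact: (@hessH l j).
by have ->: l = i by apply: val_inj; rewrite /= i_j1.
Qed.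

Lemma arnoldi_krylov :
    \dim (krylov A s`_0 m.+1) = m.+1 ->
  mxspan (row_mx V u) = krylov A s`_0 m.+1.
Proof.
move=> dimK; have szs : size s = m.+1 by rewrite size_cols addn1.
apply/esym/eqP; rewrite eqEdim (krylov_sub_chain szs arnoldi_chain) dimK.
by rewrite -szs dim_span.
Qed.

End UnreducedHessenberg.

(** * Products of shifted matrices *)

Section ShiftedProducts.
Variable F : fieldType.

(** Each factor widens the lower band by one diagonal. On the outermost diagonal a single term of
    the matrix product survives, so its entries are products of subdiagonal entries of [H]. *)
Lemma unreduced_hessenberg_shifts (m : nat) (H : 'M[F]_m) (s : seq F)
    (P := \prod_(z <- s) (H - z%:M)) :
    (forall i j : 'I_m, (j.+1 < i)%N -> H i j = 0) ->
    (forall i j : 'I_m, i = j.+1 :> nat -> H i j != 0) ->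
  (forall i j : 'I_m, (j + size s < i)%N -> P i j = 0) /\
  (forall i j : 'I_m, i = (j + size s)%N :> nat -> P i j != 0).
Proof.
move=> hessH unredH; rewrite {}/P; elim: s => [|z s [IH0 IH1]].
  rewrite big_nil /=; split=> i j; rewrite addn0 !mxE => ij.
    by rewrite -val_eqE /= gtn_eqF.
  by rewrite -val_eqE /= ij eqxx oner_neq0.
rewrite big_cons -mulmxE; set P := \prod_(y <- s) _ in IH0 IH1 *.
have shiftE (i l : 'I_m) : l != i -> (H - z%:M) i l = H i l.
  by move=> li; rewrite !mxE eq_sym (negPf li) subr0.
split=> i j /=; rewrite addnS => ij; rewrite mxE.
  apply: big1 => l _; have [lt_l|le_l] := ltnP (j + size s) l.
    by rewrite IH0 // mulr0.
  have lt_li : (l.+1 < i)%N by rewrite (leq_ltn_trans _ ij).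
  by rewrite shiftE ?hessH ?mul0r // -val_eqE /= ltn_eqF // ltnW.
have lt_l : (j + size s < m)%N by rewrite ltnW // -ij ltn_ord.
rewrite (bigD1 (Ordinal lt_l)) //= big1 ?addr0 => [|l].
  rewrite mulf_neq0 ?IH1 // shiftE ?unredH //.
  by rewrite -val_eqE /= ij ltn_eqF.
rewrite -val_eqE /= => neq_l; have [lt_jl|le_l] := ltnP (j + size s) l.
  by rewrite IH0 // mulr0.
have lt_li : (l.+1 < i)%N by rewrite ij !ltnS ltn_neqAle neq_l.
by rewrite shiftE ?hessH ?mul0r // -val_eqE /= ltn_eqF // ltnW.
Qed.

Lemma row_free_tr_lsubmx (k p : nat) (P : 'M[F]_(k + p)) :
    (forall i j : 'I_(k + p), (j + p < i)%N -> P i j = 0) ->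
    (forall i j : 'I_(k + p), i = (j + p)%N :> nat -> P i j != 0) ->
  row_free (lsubmx P)^T.
Proof.
move=> P0 P1; apply: inj_row_free => v vP0; apply/rowP=> i0; rewrite mxE.
apply/eqP/negPn/negP=> vi0.
(* For the largest [i] with [v 0 i] nonzero, only the term of [i] survives at position [i + p]:
   later coefficients vanish, and earlier columns of [P] end higher up. *)
have [i vi max_i] := @arg_maxnP _ i0 (fun i => v 0 i != 0) val vi0.
have lt_ip : (i + p < k + p)%N by rewrite ltn_add2r.
have := congr1 (fun M : 'rV_(k + p) => M 0 (Ordinal lt_ip)) vP0.
rewrite !mxE (bigD1 i) //= big1 => [|j neq_ji]; last first.
  have [lt_ij | le_ji] := ltnP i j.
    have [->|/max_i] := eqVneq (v 0 j) 0; first by rewrite mul0r.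
    by rewrite /= leqNgt lt_ij.
  rewrite !mxE P0 ?mulr0 //= ltn_add2r ltn_neqAle le_ji andbT.
  by rewrite val_eqE.
rewrite addr0 => /eqP; rewrite mulf_eq0 (negPf vi) !mxE /=.
by apply/negP; apply: P1.
Qed.

Lemma char_poly_shifts (p : nat) (N : 'M[F]_p) (s : seq F) :
  char_poly N = \prod_(z <- s) ('X - z%:P) -> \prod_(z <- s) (N - z%:M) = 0.
Proof.
case: p N => [|p] N charN; first by rewrite flatmx0 [RHS]flatmx0.
have := Cayley_Hamilton N; rewrite charN rmorph_prod => <-.
by apply: eq_bigr => z _; rewrite rmorphB /= horner_mx_X horner_mx_C.
Qed.

Lemma block_triangular_shifts (k p : nat) (S : 'M[F]_(k + p)) (s : seq F)
    (P := \prod_(z <- s) (S - z%:M)) :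
    dlsubmx S = 0 ->
  dlsubmx P = 0 /\ drsubmx P = \prod_(z <- s) (drsubmx S - z%:M).
Proof.
move=> S0; rewrite {}/P; elim: s => [|z s [IH0 IH1]].
  rewrite !big_nil (_ : 1 = 1%:M :> 'M[F]_(k + p)) // scalar_mx_block.
  by rewrite block_mxKdl block_mxKdr.
rewrite !big_cons -!mulmxE; set P := \prod_(y <- s) (S - _) in IH0 IH1 *.
have -> : (S - z%:M) *m P =
    block_mx ((ulsubmx S - z%:M) *m ulsubmx P)
             ((ulsubmx S - z%:M) *m ursubmx P + ursubmx S *m drsubmx P)
             0 ((drsubmx S - z%:M) *m drsubmx P).
  rewrite -[S in LHS]submxK -[P in LHS]submxK S0 IH0 (scalar_mx_block _ _ z).
  rewrite opp_block_mx add_block_mx mulmx_block.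
  by rewrite !subr0 !mulmx0 !mul0mx !addr0 !add0r.
by rewrite block_mxKdl block_mxKdr IH1.
Qed.

Lemma shifts_conj (m : nat) (H S P : 'M[F]_m) (s : seq F) :
    H *m P = P *m S ->
  \prod_(z <- s) (H - z%:M) *m P = P *m \prod_(z <- s) (S - z%:M).
Proof.
move=> HP; elim: s => [|z s IHs]; first by rewrite !big_nil mul1mx mulmx1.
rewrite !big_cons -!mulmxE -mulmxA IHs !mulmxA; congr (_ *m _).
by rewrite mulmxBl mulmxBr HP scalar_mxC.
Qed.

End ShiftedProducts.

(** * Ranges of shifted products, with matrices over [F] and shifts in an extension [L] *)

Section Contraction.
Variables (F L : fieldType) (f : {rmorphism F -> L}) (k p : nat).
Implicit Types (H P Q S G : 'M[F]_(k + p)) (s : seq L).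

(* By Cayley-Hamilton, the shifted product of [S] has zero bottom rows. *)
Lemma shifts_sub_invariant H P S G s :
    P \in unitmx -> H *m P = P *m S -> dlsubmx S = 0 ->
    map_poly f (char_poly (drsubmx S)) = \prod_(z <- s) ('X - z%:P) ->
    \prod_(z <- s) (map_mx f H - z%:M) = map_mx f G ->
  (G^T <= (lsubmx P)^T)%MS.
Proof.
move=> uP HP S0 specS prodH.
have HPc : map_mx f H *m map_mx f P = map_mx f P *m map_mx f S.
  by rewrite -!map_mxM HP.
have S0c : dlsubmx (map_mx f S) = 0 by rewrite -map_dlsubmx S0 map_mx0.
have := shifts_conj s HPc; have [] := block_triangular_shifts s S0c.
rewrite prodH -map_mxM; move: (\prod_(z <- s) _) => Z Z0.
rewrite -map_drsubmx char_poly_shifts -?map_char_poly // => Z1 GP.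
have sGP : ((G *m P)^T <= (lsubmx P)^T)%MS.
  (* Base change along [f] preserves and reflects row-space inclusion, so the check takes place over
     [L], where the shifts live. *)
  rewrite -(map_submx f) -!map_trmx GP -[Z]submxK Z0 Z1 map_lsubmx.
  rewrite -[map_mx f P in X in (X <= _)%MS]hsubmxK mul_row_block !mulmx0 !addr0.
  by rewrite -mul_mx_row trmx_mul submxMl.
have uPT : P^T \in unitmx by rewrite unitmx_tr.
by rewrite -[G^T](mulKmx uPT) -trmx_mul (submx_trans _ sGP) // submxMl.
Qed.

(* The unreduced Hessenberg form makes the first [k] columns of the shifted
   product [Q *m Rf] independent, and they are combinations of the first [k]
   columns of [Q] because [Rf] is triangular. *)
Lemma unreduced_shifts_QR H Q (Rf : 'M[F]_(k + p)) s :
    (forall i j : 'I_(k + p), (j.+1 < i)%N -> H i j = 0) ->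
    (forall i j : 'I_(k + p), i = j.+1 :> nat -> H i j != 0) ->
    size s = p -> is_trig_mx Rf^T ->
    \prod_(z <- s) (map_mx f H - z%:M) = map_mx f (Q *m Rf) ->
  ((lsubmx Q)^T <= (Q *m Rf)^T)%MS /\ \rank (lsubmx Q)^T = k.
Proof.
move=> hessH unredH size_s trigRf; set G := Q *m Rf => prodH.
have sGQ : ((lsubmx G)^T <= (lsubmx Q)^T)%MS.
  have Rf0 : dlsubmx Rf = 0.
    apply/matrixP=> i j; rewrite !mxE.
    have /is_trig_mxP/(_ (lshift p j) (rshift k i)) := trigRf.
    by rewrite mxE /= => -> //; rewrite ltn_addr.
  rewrite /G -[Q in Q *m Rf]hsubmxK -[Rf]submxK Rf0 mul_row_block mulmx0 addr0.
  by rewrite row_mxKl trmx_mul submxMl.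
have rankG : \rank (lsubmx G)^T = k.
  have [|| G0 G1] := @unreduced_hessenberg_shifts _ _ (map_mx f H) s.
  - by move=> i j /hessH Hij; rewrite mxE Hij rmorph0.
  - by move=> i j /unredH Hij; rewrite mxE fmorph_eq0.
  move: G0 G1; rewrite prodH size_s => G0 G1.
  rewrite -(mxrank_map f) -map_trmx map_lsubmx.
  by apply/eqP; apply: row_free_tr_lsubmx.
have rankQ : \rank (lsubmx Q)^T = k.
  by apply/eqP; rewrite eqn_leq rank_leq_row -{1}rankG mxrankS.
split=> //; rewrite (@submx_trans _ _ _ _ _ _ (lsubmx G)^T) //.
  (* Equal ranks turn the inclusion [sGQ] into an equality, which allows it to be reversed. *)
  by rewrite -(mxrank_leqif_sup sGQ) rankG rankQ.
rewrite -[G in X in (_ <= X)%MS]hsubmxK tr_row_mx.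
by apply/submxP; exists (row_mx 1%:M 0); rewrite mul_row_col mul1mx mul0mx addr0.
Qed.

End Contraction.

(** * Comparison of the two methods over one full cycle *)

Theorem theorem3p1 (R : realType) (n d k p : nat) (A : 'M[R]_n)
    (Omega : 'M[R]_(d, n)) (eps : R)
    (V U : 'M[R]_(n, k)) (H T : 'M[R]_k) (beta : R) (b : 'cV[R]_k)
    (u : 'cV[R]_n) (ret disc : seq R[i]) (Vplus Uplus : 'M[R]_(n, k)) :
  0 <= eps < 1 ->
  \dim (krylov A (V *m evec R k 1) (k + p + 1)) = (k + p + 1)%N ->
  eps_embedding Omega eps (krylov A (V *m evec R k 1) (k + p + 1)) ->
  randomized_Arnoldi A Omega V H beta u ->
  randomized_Krylov_Schur A Omega U T b u ->
  mxspan V = mxspan U ->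
  (forall z : R[i], z \in ret -> z \notin disc) ->
  rIRA_cycle A Omega p V u ret disc Vplus ->
  rKS_cycle A Omega p U u ret disc Uplus ->
  mxspan Vplus = mxspan Uplus.
Proof.
move=> /andP[_ eps_lt1] + + _ _ spanVU _.
(* [V *m evec R k 1] is the first column of [V] only for positive [k]; for [k = 0] both results are
   empty matrices. *)
have [k0 | k_gt0] := posnP k.
  have thin (M N : 'M[R]_(n, k)) : M = N.
    by move: M N; rewrite k0 => M N; rewrite [M]thinmx0 [N]thinmx0.
  by rewrite (thin Vplus Uplus).
rewrite addn1 => dimK emb.
move=> [Vm [um [Hm [bt [Q [expV [AV hessH] [_ size_disc _ _] rIRA ->]]]]]].
case: rIRA => _ [Rf trigRf prodH].
move=> [Um [um' [B [bm [Q' [expU AU _ rKS ->]]]]]].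
case: rKS => Q1 [Q2 [[oQ1 _] [oQ2 _] S0 [_ spec_disc] ->]].
have Ve1 : V *m evec R k 1 = (cols (row_mx Vm um))`_0.
  rewrite expV nth_expand ?size_cols ?addn1 // (nth_cols_row_mx V u (Ordinal k_gt0)).
  by rewrite colE; congr (_ *m _); apply/colP=> i; rewrite !mxE eqxx andbT eqSS.
rewrite Ve1 in dimK emb.
have spanW := arnoldi_krylov AV hessH dimK.
have unredH i j := arnoldi_unreduced AV hessH (i := i) (j := j) dimK.
(* The [k + p + 1] columns span a space of that dimension, hence are independent and can be
   cancelled on the left. *)
have injW l (X : 'M_(k + p + 1, l)) : row_mx Vm um *m X = 0 -> X = 0.
  move=> WX0; apply: trmx_inj; rewrite trmx0.
  have freeW : row_free (row_mx Vm um)^T.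
    rewrite /row_free mxrank_tr eqn_leq rank_leq_col.
    by rewrite (leq_trans _ (dim_mxspan_le_rank _)) // spanW dimK addn1.
  by apply: (row_free_inj freeW); rewrite -trmx_mul WX0 trmx0 mul0mx.
have [eq_um eq_span] : um' = um /\ mxspan Vm = mxspan Um.
  have [||a [c [x [aV cU eq_ac]]]] :=
      @expand_same _ _ _ A Omega p (cols (row_mx V u)) (cols (row_mx U u)).
  - by rewrite -expV => x xW; apply: eps_embedding_inj eps_lt1 emb _ _; rewrite -spanW.
  - by exists (cols V), (cols U), u; rewrite !cols_row_mx.
  move: aV cU; rewrite -expV -expU !cols_row_mx => /rcons_inj[aV <-] /rcons_inj[cU ->].
  by rewrite /mxspan aV cU.
rewrite {um'}eq_um in AU expU.
have [M UM] : exists M, Um = Vm *m M.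
  have /submxP[X UX] : (Um^T <= Vm^T)%MS by rewrite -mxspan_sub eq_span.
  by exists X^T; apply: trmx_inj; rewrite trmx_mul trmxK.
have [N VN] : exists N, Vm = Um *m N.
  have /submxP[X VX] : (Vm^T <= Um^T)%MS by rewrite -mxspan_sub eq_span.
  by exists X^T; apply: trmx_inj; rewrite trmx_mul trmxK.
have [uM _] : M \in unitmx /\ N \in unitmx.
  apply: mulmx1_unit; apply/eqP; rewrite -subr_eq0; apply/eqP.
  (* The zero row turns an identity in [Vm] alone into one for the whole basis, to which [injW]
     applies. *)
  have : col_mx (M *m N - 1%:M) 0 = 0 :> 'M_(k + p + 1, k + p).
    apply: injW.
    by rewrite mul_row_col mulmx0 addr0 mulmxBr mulmxA -UM -VN mulmx1 subrr.
  by rewrite -[X in _ = X]col_mx0 => /eq_col_mx[].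
have HM : Hm *m M = M *m B.
  apply/eqP; rewrite -subr_eq0; apply/eqP.
  (* These are the coefficients, in the basis [row_mx Vm um], of the difference of the two
     expressions for [A *m Um]. *)
  have : col_mx (Hm *m M - M *m B) (bt *: (evec R (k + p) (k + p))^T *m M - bm^T) = 0.
    apply: injW; rewrite mul_row_col !mulmxBr addrACA -opprD mulmxA.
    rewrite -scalemxAl -scalemxAr !mulmxA scalemxAl -mulmxDl -AV.
    by rewrite -UM -AU UM mulmxA subrr.
  by rewrite -[X in _ = X]col_mx0 => /eq_col_mx[].
(* [P] holds the reordered Schur basis in coordinates with respect to [Vm]. *)
pose P := M *m (Q1 *m Q2); pose S := Q2^T *m (Q1^T *m B *m Q1) *m Q2.
have uP : P \in unitmx.
  by rewrite !unitmx_mul uM (mulmx1_unit oQ1).2 (mulmx1_unit oQ2).2.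
have HP : Hm *m P = P *m S.
  rewrite /P /S !mulmxA HM -(mulmxA _ Q2) (mulmx1C oQ2) mulmx1.
  by rewrite -(mulmxA _ Q1 Q1^T) (mulmx1C oQ1) mulmx1.
have GP := shifts_sub_invariant uP HP S0 spec_disc prodH.
have [QG rankQ] := unreduced_shifts_QR hessH unredH size_disc trigRf prodH.
have sQP := submx_trans QG GP.
(* The reverse inclusion is a dimension count: [lsubmx P] has only [k] columns. *)
have sPQ : ((lsubmx P)^T <= (lsubmx Q)^T)%MS.
  by rewrite -(mxrank_leqif_sup sQP) eqn_leq mxrankS // rankQ rank_leq_row.
rewrite UM -mulmxA -/P -!(mulmx_lsub Vm).
apply/eqP; rewrite eqEsubv !mxspan_sub !(trmx_mul Vm).
by apply/andP; split; apply: submxMr.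
Qed.
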